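(* Let $\varphi$ be a formula. (1) If $\varphi$ does not contain $ite$, then $|\mathcal R^*(\varphi)|=O(|\varphi|)$, i.e. the size of the rewritten formula is linear in the size of $\varphi$. (2) If $\varphi$ contains $ite$, the size of $\mathcal R^*(\varphi)$ is, in the worst case, exponentially larger than $\varphi$.
   Context: Formulas and terms over a first-order signature: $\varphi::=\top\mid\bot\mid p(u_1,\dots,u_n)\mid\neg\varphi\mid\varphi\vee\varphi\mid X\varphi\mid\varphi U\varphi\mid Y\varphi\mid\varphi S\varphi$; $u::=c\mid x\mid f(u_1,\dots,u_n)\mid next(u)\mid ite(\varphi,u,u)\mid u@\tilde F\varphi\mid u@\tilde P\varphi$ ($c,f,p$ constant, function and predicate symbols, $x$ a variable; Boolean variables are used as atomic formulas). $|\cdot|$ denotes the size (number of symbol occurrences) of a formula or term. Abbreviations: $\wedge$ as usual, $\varphi R\psi:=\neg(\neg\varphi U\neg\psi)$, $Z\varphi:=\neg Y\neg\varphi$. The variables are partitioned into inputs and outputs; an atomic formula is an input predicate ($Pred^I$) if one of its arguments contains an input variable or a subterm $next(\cdot)$ or $\cdot@\tilde F\cdot$, and an output predicate ($Pred^O$) otherwise. Let $run,end$ be fixed Boolean variables and $state:=run\vee(Z\,run\wedge end)$. For $sgn\in\{-,+\}$ the rewriting $\mathcal R^{sgn}$ is: $\mathcal R^-(Pred^I(u_1,\dots,u_n)):=\neg run\vee Pred^I(\mathcal R^-(u_1),\dots,\mathcal R^-(u_n))$; $\mathcal R^+(Pred^I(\bar u)):=run\wedge Pred^I(\mathcal R^+(u_1),\dots)$;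 $\mathcal R^{sgn}(Pred^O(\bar u)):=Pred^O(\mathcal R^{sgn}(u_1),\dots)$; $\mathcal R^{sgn}(\varphi_1\vee\varphi_2):=\mathcal R^{sgn}(\varphi_1)\vee\mathcal R^{sgn}(\varphi_2)$; $\mathcal R^-(\neg\varphi):=\neg\mathcal R^+(\varphi)$, $\mathcal R^+(\neg\varphi):=\neg\mathcal R^-(\varphi)$; $\mathcal R^-(X\varphi):=X(state\,R\,(\neg state\vee\mathcal R^-(\varphi)))$; $\mathcal R^+(X\varphi):=X(\neg state\,U\,(state\wedge\mathcal R^+(\varphi)))$; $\mathcal R^-(\varphi_1U\varphi_2):=(\neg state\vee\mathcal R^-(\varphi_1))\,U\,((state\wedge\mathcal R^-(\varphi_2))\vee Y\,end)$; $\mathcal R^+(\varphi_1U\varphi_2):=(\neg state\vee\mathcal R^+(\varphi_1))\,U\,(state\wedge\mathcal R^+(\varphi_2))$; $\mathcal R^{sgn}(Y\varphi):=Y(\neg run\,S\,(run\wedge\mathcal R^{sgn}(\varphi)))$; $\mathcal R^{sgn}(\varphi_1S\varphi_2):=(\neg state\vee\mathcal R^{sgn}(\varphi_1))\,S\,(state\wedge\mathcal R^{sgn}(\varphi_2))$; $\mathcal R^{sgn}(x):=x$, $\mathcal R^{sgn}(c):=c$, $\mathcal R^{sgn}(f(\bar u)):=f(\mathcal R^{sgn}(u_1),\dots)$, $\mathcal R^{sgn}(ite(\varphi,u_1,u_2)):=ite(\mathcal R^+(\varphi),\mathcal R^-(u_1),ite(\mathcal R^+(\neg\varphi),\mathcal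 R^-(u_2),def_{ite(\varphi,u_1,u_2)}))$ (with $def_{\dots}$ a fresh symbol), $\mathcal R^{sgn}(next(u)):=\mathcal R^{sgn}(u)@\tilde F(state)$, $\mathcal R^{sgn}(u@\tilde F\varphi):=\mathcal R^{sgn}(u)@\tilde F(state\wedge\mathcal R^+(\varphi))$, $\mathcal R^{sgn}(u@\tilde P\varphi):=\mathcal R^{sgn}(u)@\tilde P(state\wedge\mathcal R^+(\varphi))$. $\mathcal R(\varphi):=\mathcal R^-(\varphi)$ and $\mathcal R^*(\varphi):=state\,R\,(\neg state\vee\mathcal R(\varphi))$. *)

(* Defs.v *)
From HB Require Import structures.
From mathcomp Require Import all_boot.

Set Implicit Arguments.
Unset Strict Implicit.
Unset Printing Implicit Defensive.

Record signature := Signature {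
  const : Type;
  func : Type;
  pred_sym : Type;
  var : Type;
  func_arity : func -> nat;
  pred_arity : pred_sym -> nat;
  is_bool : var -> bool;
  is_input : var -> bool;  (* the other variables are the outputs *)
  run_var : {x : var | is_bool x};
  end_var : {x : var | is_bool x}
}.

Definition bvar (S : signature) : Type := {x : var S | is_bool x}.

(* An argument list of length n is a function on 'I_n. *)
Inductive formula (S : signature) : Type :=
| FTop
| FBot
| FBool of bvar S
| FPred (p : pred_sym S) of ('I_(pred_arity p) -> term S)
| FNot of formula S
| FOr of formula S & formula S
| FX of formula S
| FU of formula S & formula S
| FY of formula S
| FS of formula S & formula S
with term (S : signature) : Type :=
| TConst of const S
| TVar of var S
| TFunc (f : func S) of ('I_(func_arity f) -> term S)
| TNext of term S
| TIte of formula S & term S & term S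
| TAtF of term S & formula S
| TAtP of term S & formula S.

Arguments FTop {S}.
Arguments FBot {S}.
Arguments FBool {S} _.
Arguments FPred {S} p _.
Arguments TConst {S} _.
Arguments TVar {S} _.
Arguments TFunc {S} f _.

Definition FAnd (S : signature) (phi psi : formula S) : formula S :=
  FNot (FOr (FNot phi) (FNot psi)).

Definition FR (S : signature) (phi psi : formula S) : formula S :=
  FNot (FU (FNot phi) (FNot psi)).

Definition FZ (S : signature) (phi : formula S) : formula S :=
  FNot (FY (FNot phi)).

Fixpoint fsize (S : signature) (phi : formula S) : nat :=
  match phi with
  | FTop | FBot | FBool _ => 1
  | FPred p us => 1 + \sum_(i < pred_arity p) tsize (us i)
  | FNot a | FX a | FY a => 1 + fsize a
  | FOr a b | FU a b | FS a b => 1 + fsize a + fsize b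
  end
with tsize (S : signature) (u : term S) : nat :=
  match u with
  | TConst _ | TVar _ => 1
  | TFunc f us => 1 + \sum_(i < func_arity f) tsize (us i)
  | TNext v => 1 + tsize v
  | TIte a v w => 1 + fsize a + tsize v + tsize w
  | TAtF v a | TAtP v a => 1 + tsize v + fsize a
  end.

Fixpoint f_has_ite (S : signature) (phi : formula S) : bool :=
  match phi with
  | FTop | FBot | FBool _ => false
  | FPred p us => [exists i : 'I_(pred_arity p), t_has_ite (us i)]
  | FNot a | FX a | FY a => f_has_ite a
  | FOr a b | FU a b | FS a b => f_has_ite a || f_has_ite b
  end
with t_has_ite (S : signature) (u : term S) : bool :=
  match u with
  | TConst _ | TVar _ => false
  | TFunc f us => [exists i : 'I_(func_arity f), t_has_ite (us i)]
  | TNext v => t_has_ite v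
  | TIte _ _ _ => true
  | TAtF v a | TAtP v a => t_has_ite v || f_has_ite a
  end.

(* Occurrence, at any depth (also inside the formulas nested in terms), of an
   input variable or of a subterm next(.) or .@~F. *)
Fixpoint f_input (S : signature) (phi : formula S) : bool :=
  match phi with
  | FTop | FBot => false
  | FBool x => is_input (sval x)
  | FPred p us => [exists i : 'I_(pred_arity p), t_input (us i)]
  | FNot a | FX a | FY a => f_input a
  | FOr a b | FU a b | FS a b => f_input a || f_input b
  end
with t_input (S : signature) (u : term S) : bool :=
  match u with
  | TConst _ => false
  | TVar x => is_input x
  | TFunc f us => [exists i : 'I_(func_arity f), t_input (us i)]
  | TNext _ => true
  | TIte a v w => f_input a || t_input v || t_input w
  | TAtF _ _ => true
  | TAtP v a => t_input v || f_input a
  end.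

(* The signature of rewritten formulas: inr (phi, u1, u2) is the fresh symbol
   def_{ite(phi, u1, u2)}. *)
Definition def_sig (S : signature) : signature :=
  {| const := const S + (formula S * term S * term S);
     func := func S;
     pred_sym := pred_sym S;
     var := var S;
     func_arity := @func_arity S;
     pred_arity := @pred_arity S;
     is_bool := @is_bool S;
     is_input := @is_input S;
     run_var := run_var S;
     end_var := end_var S |}.

Definition Frun (S : signature) : formula S := FBool (run_var S).
Definition Fend (S : signature) : formula S := FBool (end_var S).
Arguments Frun {S}.
Arguments Fend {S}.

Definition Fstate (S : signature) : formula S :=
  FOr Frun (FAnd (FZ Frun) Fend).
Arguments Fstate {S}.

Inductive sign := Minus | Plus.

Definition opp (sgn : sign) : sign :=
  match sgn with Minus => Plus | Plus => Minus end.

Definition guard_input (S : signature) (sgn : sign) (inp : bool)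
    (phi : formula S) : formula S :=
  if inp then
    match sgn with
    | Minus => FOr (FNot Frun) phi
    | Plus => FAnd Frun phi
    end
  else phi.

(* A Boolean variable is an input predicate when it is itself an input. In the
   ite case, FNot (rwF Minus a) is the rewriting of FNot a with sign Plus. *)
Fixpoint rwF (S : signature) (sgn : sign) (phi : formula S) :
    formula (def_sig S) :=
  match phi with
  | FTop => FTop
  | FBot => FBot
  | FBool x =>
      guard_input sgn (f_input (FBool x)) (@FBool (def_sig S) x)
  | FPred p us =>
      guard_input sgn (f_input (FPred p us))
        (@FPred (def_sig S) p (fun i => rwT sgn (us i)))
  | FNot a => FNot (rwF (opp sgn) a)
  | FOr a b => FOr (rwF sgn a) (rwF sgn b)
  | FX a =>
      match sgn with
      | Minus => FX (FR Fstate (FOr (FNot Fstate) (rwF Minus a)))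
      | Plus => FX (FU (FNot Fstate) (FAnd Fstate (rwF Plus a)))
      end
  | FU a b =>
      match sgn with
      | Minus => FU (FOr (FNot Fstate) (rwF Minus a))
                    (FOr (FAnd Fstate (rwF Minus b)) (FY Fend))
      | Plus => FU (FOr (FNot Fstate) (rwF Plus a))
                   (FAnd Fstate (rwF Plus b))
      end
  | FY a => FY (FS (FNot Frun) (FAnd Frun (rwF sgn a)))
  | FS a b => FS (FOr (FNot Fstate) (rwF sgn a)) (FAnd Fstate (rwF sgn b))
  end
with rwT (S : signature) (sgn : sign) (u : term S) : term (def_sig S) :=
  match u with
  | TConst c => @TConst (def_sig S) (inl c)
  | TVar x => @TVar (def_sig S) x
  | TFunc f us => @TFunc (def_sig S) f (fun i => rwT sgn (us i))
  | TNext v => TAtF (rwT sgn v) Fstate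
  | TIte a v w =>
      TIte (rwF Plus a) (rwT Minus v)
        (TIte (FNot (rwF Minus a)) (rwT Minus w)
           (@TConst (def_sig S) (inr (a, v, w))))
  | TAtF v a => TAtF (rwT sgn v) (FAnd Fstate (rwF Plus a))
  | TAtP v a => TAtP (rwT sgn v) (FAnd Fstate (rwF Plus a))
  end.

Definition rw (S : signature) (phi : formula S) : formula (def_sig S) :=
  rwF Minus phi.

Definition rw_star (S : signature) (phi : formula S) : formula (def_sig S) :=
  FR Fstate (FOr (FNot Fstate) (rw phi)).

(* Main.v *)
Require Import Defs.
From mathcomp Require Import all_boot.
From mathcomp Require Import zify.
(* Imported again because [tuple] also exports a [tsize]. *)
Import Defs.

(** Away from [ite], the rewriting makes one recursive call on each immediate
    subexpression and adds a bounded number of symbols, hence linearity.  At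
    [ite(phi, u, v)] the condition is rewritten twice, once with each sign; at
    most doubling at each node gives the exponential upper bound.  Conversely,
    nesting [phi |-> p(.., ite(phi, t, t), ..)] adds a constant to the size of
    the formula but doubles the size of its rewriting. *)

Set Implicit Arguments.
Unset Strict Implicit.
Unset Printing Implicit Defensive.

Scheme formula_term_ind := Induction for formula Sort Prop
with term_formula_ind := Induction for term Sort Prop.
Combined Scheme formula_term_mutind from formula_term_ind, term_formula_ind.

(** * Elementary size estimates *)

Section SizeBounds.
Variable S : signature.
Implicit Types (phi : formula S) (u : term S).

Lemma fsize_gt0 phi : 0 < fsize phi. Proof. by case: phi. Qed.

Lemma tsize_gt0 u : 0 < tsize u. Proof. by case: u. Qed.

Lemma fsize_guard_input sgn b phi :
  fsize phi <= fsize (guard_input sgn b phi) <= 5 + fsize phi.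
Proof. by case: b sgn => -[] /=; lia. Qed.

End SizeBounds.

(** Both sides are used: the upper one in the two upper bounds, the lower one for the doubling under
    nesting. *)
Lemma fsize_rwF_FPred (S : signature) (p : pred_sym S)
    (us : 'I_(pred_arity p) -> term S) sgn :
  1 + \sum_(i < pred_arity p) tsize (rwT sgn (us i))
    <= fsize (rwF sgn (FPred p us))
    <= 6 + \sum_(i < pred_arity p) tsize (rwT sgn (us i)).
Proof.
exact: (fsize_guard_input sgn (f_input (FPred p us))
          (@FPred (def_sig S) p (fun i => rwT sgn (us i)))).
Qed.

(** * Upper bounds on the size of the rewriting *)

Lemma sum_leq_prod (I : Type) (r : seq I) (F : I -> nat) :
  (forall i, 1 < F i) -> \sum_(i <- r) F i <= \prod_(i <- r) F i.
Proof.
move=> F_gt1.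
elim: r => [|i r IHr]; first by rewrite !big_nil.
(* The step rests on [a + b <= a * b] for [a, b >= 2]; a singleton is treated apart because the
   empty product is only 1. *)
rewrite !big_cons; case: r IHr => [|j r] IHr.
  by rewrite !big_nil addn0 muln1.
have P_gt1 : 1 < \prod_(k <- j :: r) F k.
  by apply: leq_trans IHr; rewrite big_cons ltn_addr.
by have := F_gt1 i; nia.
Qed.

Lemma sum_expn_leq (n : nat) (F : 'I_n -> nat) :
  (forall i, 0 < F i) -> \sum_(i < n) 2 ^ F i <= 2 ^ \sum_(i < n) F i.
Proof.
move=> F_gt0; rewrite expn_sum; apply: sum_leq_prod => i.
by rewrite -(expn0 2) ltn_exp2l.
Qed.

(** Each source symbol yields a bounded number of symbols, the worst case being 32 for [FU] with
    sign [Minus] ([Fstate] has size 11), so 50 leaves slack. The sign is quantified inside the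
    induction because negation flips it. *)
Lemma rw_size_linear (S : signature) :
  (forall phi : formula S, ~~ f_has_ite phi ->
     forall sgn, fsize (rwF sgn phi) <= 50 * fsize phi) /\
  (forall u : term S, ~~ t_has_ite u ->
     forall sgn, tsize (rwT sgn u) <= 50 * tsize u).
Proof.
have args n (us : 'I_n -> term S) (IH : forall i, ~~ t_has_ite (us i) ->
      forall sgn, tsize (rwT sgn (us i)) <= 50 * tsize (us i)) :
    ~~ [exists i, t_has_ite (us i)] -> forall sgn,
    \sum_(i < n) tsize (rwT sgn (us i)) <= 50 * \sum_(i < n) tsize (us i).
  rewrite negb_exists => /forallP us_ite sgn.
  by rewrite big_distrr; apply: leq_sum => i _; apply: IH.
apply: formula_term_mutind => //=.
- move=> x _ sgn.
  have := fsize_guard_input sgn (is_input (sval x)) (@FBool (def_sig S) x).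
  by rewrite /=; lia.
- move=> p us IH /(args _ _ IH) le_us sgn.
  have /andP[_ le_p] := fsize_rwF_FPred us sgn; apply: leq_trans le_p _.
  by rewrite mulnDr; apply: leq_add (le_us sgn).
- by move=> a IH /IH le_a sgn; have := le_a (opp sgn); lia.
- move=> a IHa b IHb; rewrite negb_or => /andP[/IHa le_a /IHb le_b] sgn.
  by have := le_a sgn; have := le_b sgn; lia.
- move=> a IH /IH le_a sgn; have := le_a sgn.
  by case: sgn => /=; lia.
- move=> a IHa b IHb; rewrite negb_or => /andP[/IHa le_a /IHb le_b] sgn.
  have := le_a sgn; have := le_b sgn.
  by case: sgn => /=; lia.
- by move=> a IH /IH le_a sgn; have := le_a sgn; lia.
- move=> a IHa b IHb; rewrite negb_or => /andP[/IHa le_a /IHb le_b] sgn.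
  by have := le_a sgn; have := le_b sgn; lia.
- move=> f us IH /(args _ _ IH) le_us sgn.
  by rewrite mulnDr; apply: leq_add (le_us sgn).
- by move=> v IH /IH le_v sgn; have := le_v sgn; lia.
- move=> v IHv a IHa; rewrite negb_or => /andP[/IHv le_v /IHa le_a] sgn.
  by have := le_v sgn; have := le_a Plus; lia.
- move=> v IHv a IHa; rewrite negb_or => /andP[/IHv le_v /IHa le_a] sgn.
  by have := le_v sgn; have := le_a Plus; lia.
Qed.

(** Each node brings its own factor [2 ^ 6 = 64], which absorbs both the added symbols and the
    second copy of an [ite] condition. Sums over children become products, since every power
    involved is at least 2. *)
Lemma rw_size_exponential (S : signature) :
  (forall (phi : formula S) sgn, fsize (rwF sgn phi) <= 2 ^ (6 * fsize phi)) /\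
  (forall (u : term S) sgn, tsize (rwT sgn u) <= 2 ^ (6 * tsize u)).
Proof.
have pow_ge2 n : 0 < n -> 2 <= 2 ^ (6 * n).
  by move=> n_gt0; rewrite -{1}(expn1 2) leq_exp2l //; lia.
have add_pow k n : k <= 63 -> k + 2 ^ n <= 64 * 2 ^ n.
  by have : 0 < 2 ^ n; [rewrite expn_gt0 | lia].
have sum_prod m n : 2 <= m -> 2 <= n -> m + n <= m * n by nia.
have fpow (a : formula S) := pow_ge2 _ (fsize_gt0 a).
have tpow (u : term S) := pow_ge2 _ (tsize_gt0 u).
have args n (us : 'I_n -> term S) (IH : forall i sgn,
      tsize (rwT sgn (us i)) <= 2 ^ (6 * tsize (us i))) sgn :
    \sum_(i < n) tsize (rwT sgn (us i)) <= 2 ^ (6 * \sum_(i < n) tsize (us i)).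
  rewrite big_distrr; apply: leq_trans (sum_expn_leq _) => [|i].
    by apply: leq_sum => i _; apply: IH.
  by rewrite muln_gt0 tsize_gt0.
apply: formula_term_mutind => //=.
- move=> x sgn.
  have := fsize_guard_input sgn (is_input (sval x)) (@FBool (def_sig S) x).
  by rewrite /=; lia.
- move=> p us /args le_us sgn.
  have /andP[_ le_p] := fsize_rwF_FPred us sgn; apply: leq_trans le_p _.
  rewrite mulnDr expnD.
  exact: leq_trans (leq_add (leqnn 6) (le_us sgn)) (add_pow _ _ _).
- move=> a IH sgn; rewrite mulnDr expnD -[2 ^ (6 * 1)]/64.
  by have := IH (opp sgn); have := fpow a; lia.
- move=> a IHa b IHb sgn; rewrite 2!mulnDr 2!expnD -[2 ^ (6 * 1)]/64.
  by have := IHa sgn; have := IHb sgn; have := fpow a; have := sum_prod _ _ (fpow a) (fpow b); lia.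
- move=> a IH sgn; rewrite mulnDr expnD -[2 ^ (6 * 1)]/64.
  have := IH sgn; have := fpow a.
  by case: sgn => /=; lia.
- move=> a IHa b IHb sgn; rewrite 2!mulnDr 2!expnD -[2 ^ (6 * 1)]/64.
  have := IHa sgn; have := IHb sgn; have := fpow a.
  have := fpow b; have := sum_prod _ _ (fpow a) (fpow b).
  by case: sgn => /=; lia.
- move=> a IH sgn; rewrite mulnDr expnD -[2 ^ (6 * 1)]/64.
  by have := IH sgn; have := fpow a; lia.
- move=> a IHa b IHb sgn; rewrite 2!mulnDr 2!expnD -[2 ^ (6 * 1)]/64.
  by have := IHa sgn; have := IHb sgn; have := fpow a; have := sum_prod _ _ (fpow a) (fpow b); lia.
- move=> f us /args le_us sgn.
  rewrite mulnDr expnD.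
  exact: leq_trans (leq_add (leqnn 1) (le_us sgn)) (add_pow _ _ _).
- move=> v IH sgn; rewrite mulnDr expnD -[2 ^ (6 * 1)]/64.
  by have := IH sgn; have := tpow v; lia.
(* With [A], [V], [W] the powers bounding condition and branches, the size is at most
   [4 + 2 * A + V + W], and [A + V + W <= A * V * W] by [sum_prod] applied twice. *)
- move=> a IHa v IHv w IHw _; rewrite 3!mulnDr 3!expnD -[2 ^ (6 * 1)]/64.
  have := IHa Plus; have := IHa Minus; have := IHv Minus; have := IHw Minus.
  have := fpow a; have := tpow v; have := tpow w.
  have le_av := sum_prod _ _ (fpow a) (tpow v).
  have av_ge2 := leq_trans (leq_trans (fpow a) (leq_addr _ _)) le_av.
  by have := sum_prod _ _ av_ge2 (tpow w); lia.
- move=> v IHv a IHa sgn; rewrite 2!mulnDr 2!expnD -[2 ^ (6 * 1)]/64.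
  have := IHv sgn; have := IHa Plus; have := tpow v; have := fpow a.
  by have := sum_prod _ _ (tpow v) (fpow a); lia.
- move=> v IHv a IHa sgn; rewrite 2!mulnDr 2!expnD -[2 ^ (6 * 1)]/64.
  have := IHv sgn; have := IHa Plus; have := tpow v; have := fpow a.
  by have := sum_prod _ _ (tpow v) (fpow a); lia.
Qed.

(** Terms enter formulas only as predicate arguments, so an [ite] yields an argument position and a
    term, which is all that nesting requires. *)
Lemma f_has_ite_pred (S : signature) (phi : formula S) : f_has_ite phi ->
  exists p : pred_sym S, inhabited ('I_(pred_arity p) * term S).
Proof.
elim: phi => //= [p us /existsP[i _]|a IHa b IHb|a IHa b IHb|a IHa b IHb].
  by exists p; constructor; exact: (i, us i).
all: by case/orP.
Qed.

(** * Nested conditions and the exponential lower bound *)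

Section Nesting.
Variables (S : signature) (p : pred_sym S) (i0 : 'I_(pred_arity p)).
Variable t : term S.

Definition wrap_ite (phi : formula S) : formula S :=
  FPred p (fun i => if i == i0 then TIte phi t t else t).

(** Subtracting 1 discounts [FTop] itself, leaving the symbols added by one layer. *)
Definition wrap_cost : nat := fsize (wrap_ite FTop) - 1.

Lemma f_has_ite_wrap phi : f_has_ite (wrap_ite phi).
Proof. by apply/existsP; exists i0; rewrite eqxx. Qed.

Lemma fsize_wrap phi : fsize (wrap_ite phi) = fsize phi + wrap_cost.
Proof.
have sum_args psi : \sum_i tsize (if i == i0 then TIte psi t t else t) =
    1 + fsize psi + tsize t + tsize t + \sum_(i | i != i0) tsize t.
  rewrite (bigD1 i0) //= eqxx; congr (_ + _).
  by apply: eq_bigr => i /negPf ->.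
by rewrite /wrap_cost /= !sum_args /=; lia.
Qed.

Lemma wrap_cost_gt0 : 0 < wrap_cost.
Proof. by have := fsize_wrap FTop; rewrite /= (bigD1 i0) //= eqxx /=; lia. Qed.

(** Whatever the outer sign, the [ite] case rewrites its condition once with [Plus] and once, under
    a negation, with [Minus]. *)
Lemma fsize_rwF_wrap sgn phi :
  fsize (rwF Plus phi) + fsize (rwF Minus phi) <= fsize (rwF sgn (wrap_ite phi)).
Proof.
have /andP[+ _] := fsize_rwF_FPred
  (fun i => if i == i0 then TIte phi t t else t) sgn.
by apply: leq_trans; rewrite (bigD1 i0) //= eqxx /=; lia.
Qed.

Lemma fsize_iter_wrap q phi :
  fsize (iter q wrap_ite phi) = q * wrap_cost + fsize phi.
Proof. by elim: q => // q IHq; rewrite iterS fsize_wrap IHq; lia. Qed.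

Lemma fsize_rwF_iter_wrap q phi sgn :
  2 ^ q <= fsize (rwF sgn (iter q wrap_ite phi)).
Proof.
elim: q sgn => [|q IHq] sgn; first exact: fsize_gt0.
rewrite iterS; apply: leq_trans (fsize_rwF_wrap _ _).
by rewrite expnS mul2n -addnn leq_add.
Qed.

End Nesting.

(** * Padding by negations, to reach every large size exactly *)

Section Padding.
Variable S : signature.
Implicit Type phi : formula S.

Lemma fsize_iter_FNot r phi : fsize (iter r (@FNot S) phi) = r + fsize phi.
Proof. by elim: r => //= r ->; lia. Qed.

Lemma f_has_ite_iter_FNot r phi :
  f_has_ite (iter r (@FNot S) phi) = f_has_ite phi.
Proof. by elim: r. Qed.

Lemma fsize_rwF_iter_FNot m r phi :
  (forall sgn, m <= fsize (rwF sgn phi)) ->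
  forall sgn, m <= fsize (rwF sgn (iter r (@FNot S) phi)).
Proof.
move=> m_le; elim: r => //= r IHr sgn.
by apply: leq_trans (IHr (opp sgn)) _; lia.
Qed.

End Padding.

Lemma fsize_rw_star (S : signature) (phi : formula S) :
  fsize (rw_star phi) = 28 + fsize (rwF Minus phi).
Proof. by rewrite /= /rw; lia. Qed.

Theorem theorem5p6 :
  (exists C : nat, forall (S : signature) (phi : formula S),
      ~~ f_has_ite phi -> fsize (rw_star phi) <= C * fsize phi)
  /\
  ((exists C : nat, forall (S : signature) (phi : formula S),
      f_has_ite phi -> fsize (rw_star phi) <= 2 ^ (C * fsize phi))
   /\
   (forall S : signature, (exists psi : formula S, f_has_ite psi) ->
      exists d n0 : nat, forall n : nat, n0 <= n ->
        exists phi : formula S,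
          [/\ f_has_ite phi, fsize phi = n &
              2 ^ n <= fsize (rw_star phi) ^ d])).
Proof.
split; [|split].
(* Here [78 = 28 + 50], the 28 symbols of the outer [FR] being charged to [fsize phi >= 1]. *)
- exists 78 => S phi no_ite; rewrite fsize_rw_star.
  have [/(_ _ no_ite Minus) le_phi _] := rw_size_linear S.
  by have := fsize_gt0 phi; lia.
(* The 28 outer symbols are absorbed by a factor [2 ^ 5], whence [11 = 5 + 6]. *)
- exists 11 => S phi _; rewrite fsize_rw_star.
  have [/(_ phi Minus) le_phi _] := rw_size_exponential S.
  have le32 : 2 ^ 5 <= 2 ^ (5 * fsize phi).
    by rewrite leq_exp2l //; have := fsize_gt0 phi; lia.
  rewrite -[11]/(5 + 6) mulnDl expnD; rewrite -[2 ^ 5]/32 in le32.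
  by have : 0 < 2 ^ (6 * fsize phi); [rewrite expn_gt0 | nia].
- move=> S [psi /f_has_ite_pred[p [[i0 t]]]].
  set K := wrap_cost i0 t; have K_gt0 : 0 < K := wrap_cost_gt0 i0 t.
  (* One symbol goes to [FTop]; the other [n - 1] split into [q] layers of cost [K] and [r < K]
     negations. The threshold gives [q >= 1], hence an [ite] and
     [n <= q * K + K <= q * (2 * K + 1)]. *)
  exists (2 * K + 1), K.+1 => n n_ge.
  pose q := (n - 1) %/ K; pose r := (n - 1) %% K.
  have n_eq : n = q * K + r + 1 by rewrite -divn_eq; lia.
  have r_lt : r < K by rewrite ltn_mod.
  have q_gt0 : 0 < q by rewrite divn_gt0 //; lia.
  exists (iter r (@FNot S) (iter q (wrap_ite i0 t) FTop)); split.
  + rewrite f_has_ite_iter_FNot -(prednK q_gt0) iterS.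
    exact: f_has_ite_wrap.
  + by rewrite fsize_iter_FNot fsize_iter_wrap -/K /=; lia.
  + apply: (@leq_trans ((2 ^ q) ^ (2 * K + 1))).
      by rewrite -expnM leq_exp2l //; nia.
    rewrite leq_exp2r; last by lia.
    rewrite fsize_rw_star; apply: leq_trans (leq_addl _ _).
    by apply: fsize_rwF_iter_FNot => sgn; apply: fsize_rwF_iter_wrap.
Qed.
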